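(* Let $\Phi\in\mathcal{LP}(\mathbb{I},\mathbb{R}^n)$. Then for each $k\in\{1,\ldots,n\}$ the restrictions $$\underline{\lambda}(\cdot,\Phi)\big|_{\mathrm{Gr}(k,\mathbb{R}^n)}\quad\text{and}\quad\overline{\lambda}(\cdot,\Phi)\big|_{\mathrm{Gr}(k,\mathbb{R}^n)}$$ are continuous (with respect to the gap metric on $\mathrm{Gr}(k,\mathbb{R}^n)$) and bounded.
   Context: Let $n\ge 1$, let $|\cdot|$ be an arbitrary fixed norm on $\mathbb{R}^n$ with unit sphere $\mathcal{S}$ and induced operator norm $\|\cdot\|$. Let $\mathbb{I}\subset\mathbb{R}$ be compact (not necessarily an interval), $t_-=\min\mathbb{I}$, $t_+=\max\mathbb{I}$, $t_-<t_+$. Put $\mathbb{I}^2_{\neq}=\{(t,s)\in\mathbb{I}\times\mathbb{I}: t\neq s\}$ and let $\overline{\mathbb{I}^2_{\neq}}$ be its closure in $\mathbb{R}^2$. A linear process on $\mathbb{I}$ is a family $\Phi(t,s)\in GL(n,\mathbb{R})$, $t,s\in\mathbb{I}$, such that $(t,s,x)\mapsto\Phi(t,s)x$ is continuous, $\Phi(t,t)=\mathrm{id}$, $\Phi(t,s)\Phi(s,r)=\Phi(t,r)$ for all $t,s,r\in\mathbb{I}$, and $t\mapsto\Phi(t,s)$ is Lipschitz continuous in operator norm for every $s\in\mathbb{I}$. For continuous $f:\mathbb{I}\to(0,\infty)$ the logarithmic difference quotient is $\Delta(f)(t,s)=\frac{\ln f(t)-\ln f(s)}{t-s}$, $(t,s)\in\mathbb{I}^2_{\neq}$.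 Standing assumption: $\mathcal{LP}(\mathbb{I},\mathbb{R}^n)$ denotes the set of linear processes $\Phi$ on $\mathbb{I}$ for which $(x,t,s)\mapsto\Delta(|\Phi(\cdot,t_-)x|)(t,s)$ extends continuously from $\mathcal{S}\times\mathbb{I}^2_{\neq}$ to $\mathcal{S}\times\overline{\mathbb{I}^2_{\neq}}$; the extension is denoted by the same symbol. $\mathrm{Gr}(k,\mathbb{R}^n)$ is the set of $k$-dimensional subspaces of $\mathbb{R}^n$, with the gap metric $\Theta(L,M)=\|\pi_L-\pi_M\|$, where $\pi_X$ is the orthogonal (Euclidean) projection onto $X$. Growth rates: for a subspace $X\neq\{0\}$, $$\underline{\lambda}(X,\Phi)=\min_{x\in X\cap\mathcal{S},\,(t,s)\in\overline{\mathbb{I}^2_{\neq}}}\Delta(|\Phi(\cdot,t_-)x|)(t,s),\qquad \overline{\lambda}(X,\Phi)=\max_{x\in X\cap\mathcal{S},\,(t,s)\in\overline{\mathbb{I}^2_{\neq}}}\Delta(|\Phi(\cdot,t_-)x|)(t,s).$$ *)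

(* Defs.v *)
From HB Require Import structures.
From mathcomp Require Import all_boot all_order all_algebra.
From mathcomp Require Import all_classical all_reals all_analysis.

Set Implicit Arguments.
Unset Strict Implicit.
Unset Printing Implicit Defensive.

Import Order.TTheory GRing.Theory Num.Theory.
Import numFieldNormedType.Exports.

Local Open Scope classical_set_scope.
Local Open Scope ring_scope.

Section minmax.
Context {R : realType}.
Implicit Types A : set R.

Definition is_min A (m : R) := A m /\ lbound A m.
Definition is_max A (m : R) := A m /\ ubound A m.

(* The value is arbitrary when A has no least (resp. greatest) element. *)
Definition set_min A : R := get (is_min A).
Definition set_max A : R := get (is_max A).

Lemma set_minE A m : is_min A m -> set_min A = m.
Proof.
move=> Am; have [Am1 lAm1] := getPex (ex_intro _ m Am : exists x, is_min A x).
by apply/eqP; rewrite eq_le; case: Am => Am lAm; rewrite lAm1 ?lAm.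
Qed.

Lemma set_maxE A m : is_max A m -> set_max A = m.
Proof.
move=> Am; have [Am1 lAm1] := getPex (ex_intro _ m Am : exists x, is_max A x).
by apply/eqP; rewrite eq_le; case: Am => Am lAm; rewrite lAm1 ?lAm.
Qed.

End minmax.

Section norms.
Context {R : realType} {n : nat}.
Implicit Types (x y : 'cV[R]_n) (A P : 'M[R]_n) (N : 'cV[R]_n -> R)
  (X Y : {vspace 'cV[R]_n}).

(* N is an arbitrary norm on R^n, unrelated to the canonical (sup) norm of
   'cV[R]_n, which only serves to provide the usual topology of R^n. *)
Definition is_norm N :=
  [/\ forall x, 0 <= N x,
      forall x, N x = 0 -> x = 0,
      forall (a : R) x, N (a *: x) = `|a| * N x
    & forall x y, N (x + y) <= N x + N y].

Definition unit_sphere N : set 'cV[R]_n := [set x | N x = 1].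

Definition opnorm N A : R := sup [set N (A *m x) | x in unit_sphere N].

Definition dot x y : R := \sum_(i < n) x i 0 * y i 0.

Definition is_orthproj X P :=
  forall x, P *m x \in X /\ (forall y, y \in X -> dot (x - P *m x) y = 0).

Definition orthproj X : 'M[R]_n := get (is_orthproj X).

Definition gap N X Y : R := opnorm N (orthproj X - orthproj Y).

Lemma dotE x y : dot x y = (x^T *m y) 0 0.
Proof. by rewrite mxE; apply: eq_bigr => i _; rewrite mxE. Qed.

Lemma dot_eq0 x : dot x x = 0 -> x = 0.
Proof.
move=> /eqP; rewrite psumr_eq0 => [/allP x0|i _]; last first.
  by rewrite -expr2 sqr_ge0.
apply/colP => i; rewrite mxE; have := x0 i (mem_index_enum i).
by rewrite /= mulf_eq0 orbb => /eqP.
Qed.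

Lemma orthproj_exists X : exists P, is_orthproj X P.
Proof.
pose b := vbasis X.
pose B : 'M[R]_(n, \dim X) := \matrix_(i, j) b`_j i 0.
have BE (c : 'cV_(\dim X)) : B *m c = \sum_i c i 0 *: b`_i.
  apply/colP => j; rewrite mxE summxE; apply: eq_bigr => i _.
  by rewrite !mxE mulrC.
have Bin c : B *m c \in X.
  rewrite BE memv_suml // => i _; rewrite memvZ // vbasis_mem //.
  by rewrite mem_nth // size_tuple.
have Bex y : y \in X -> exists c, y = B *m c.
  move=> yX; exists (\col_i coord b i y).
  rewrite BE {1}(coord_vbasis yX); apply: eq_bigr => i _.
  by rewrite mxE.
have B0 (c : 'cV_(\dim X)) : B *m c = 0 -> c = 0.
  move=> Bc0; apply/colP => i; rewrite mxE.
  have /freeP := basis_free (vbasisP X).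
  by move=> /(_ (fun j => c j 0)); apply; rewrite -BE.
have BBu : B^T *m B \in unitmx.
  rewrite -unitmx_tr -row_free_unit -kermx_eq0.
  apply/eqP/row_matrixP => i; rewrite row0.
  set r := row i _.
  have rBB : r *m (B^T *m B)^T = 0 by rewrite -row_mul mulmx_ker row0.
  apply: trmx_inj; rewrite trmx0; apply: B0; apply: dot_eq0.
  rewrite trmx_mul trmxK mulmxA in rBB.
  by rewrite dotE trmx_mul trmxK mulmxA rBB mul0mx mxE.
exists (B *m invmx (B^T *m B) *m B^T) => x; split.
  by rewrite -!mulmxA.
move=> y /Bex[c ->]; rewrite dotE mulmxA.
suff -> : (x - B *m invmx (B^T *m B) *m B^T *m x)^T *m B = 0.
  by rewrite mul0mx mxE.
apply: trmx_inj; rewrite trmx_mul trmxK trmx0 mulmxBr -!mulmxA.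
by rewrite [B^T *m (B *m _)]mulmxA mulmxA mulmxV // mul1mx subrr.
Qed.

Lemma orthprojP X : is_orthproj X (orthproj X).
Proof. exact: getPex (orthproj_exists X). Qed.

End norms.

Section linear_processes.
Context {R : realType} {n : nat}.
Implicit Types (N : 'cV[R]_n -> R) (I : set R) (Phi : R -> R -> 'M[R]_n).

Definition off_diag I : set (R * R) :=
  [set p | [/\ I p.1, I p.2 & p.1 != p.2]].

(* Only the values of Phi on I x I are relevant. *)
Definition linear_process N I Phi :=
  [/\ forall t s, I t -> I s -> Phi t s \in unitmx,
      {within [set p : R * R * 'cV[R]_n | I p.1.1 /\ I p.1.2],
        continuous (fun p => Phi p.1.1 p.1.2 *m p.2)},
      forall t, I t -> Phi t t = 1%:M,
      forall t s r, I t -> I s -> I r -> Phi t s *m Phi s r = Phi t r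
    & forall s, I s -> exists L : R, forall t t', I t -> I t' ->
        opnorm N (Phi t s - Phi t' s) <= L * `|t - t'| ].

Definition log_diff_quot (f : R -> R) (p : R * R) : R :=
  (ln (f p.1) - ln (f p.2)) / (p.1 - p.2).

(* D is a continuous extension of (x, t, s) |-> Delta(|Phi(., t_-) x|)(t, s)
   to the product of the unit sphere and the closure of off_diag I; there is
   at most one such extension on this set. *)
Definition is_delta_ext N I Phi (D : 'cV[R]_n * (R * R) -> R) :=
  {within unit_sphere N `*` closure (off_diag I), continuous D} /\
  forall x p, unit_sphere N x -> off_diag I p ->
    D (x, p) = log_diff_quot (fun t => N (Phi t (set_min I) *m x)) p.

Definition LP N I : set (R -> R -> 'M[R]_n) :=
  [set Phi | linear_process N I Phi /\ exists D, is_delta_ext N I Phi D].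

Definition delta_ext N I Phi : 'cV[R]_n * (R * R) -> R :=
  get (is_delta_ext N I Phi).

Definition growth_values N I Phi (X : {vspace 'cV[R]_n}) : set R :=
  delta_ext N I Phi @`
    (([set x | x \in X] `&` unit_sphere N) `*` closure (off_diag I)).

Definition lower_rate N I Phi X : R := set_min (growth_values N I Phi X).
Definition upper_rate N I Phi X : R := set_max (growth_values N I Phi X).

End linear_processes.

Section grassmannian.
Context {R : realType} {n : nat}.

Definition Gr k : set {vspace 'cV[R]_n} := [set X | \dim X = k].

Definition gap_continuous_on (N : 'cV[R]_n -> R) (G : set {vspace 'cV[R]_n})
    (f : {vspace 'cV[R]_n} -> R) :=
  forall X, G X -> forall e : R, 0 < e -> exists2 d : R, 0 < d &
    forall Y, G Y -> gap N X Y < d -> `|f X - f Y| < e.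

Definition bounded_real_on (G : set {vspace 'cV[R]_n})
    (f : {vspace 'cV[R]_n} -> R) :=
  exists M : R, forall X, G X -> `|f X| <= M.

End grassmannian.

(* Main.v *)
Require Import Defs.
From mathcomp Require Import all_boot all_order all_algebra.
From mathcomp Require Import all_classical all_reals all_analysis.
Import Order.TTheory GRing.Theory Num.Theory.
Import numFieldNormedType.Exports.
Local Open Scope classical_set_scope.
Local Open Scope ring_scope.

(** The growth rates of [X] are the minimum and the maximum of one function
[D], the extended difference quotient, over [(X `&` S) `*` K], where [S] is the
unit sphere of [N] and [K] is the closure of the off-diagonal pairs of times.
Both [S] and [K] are compact and [D] is continuous on [S `*` K], so [D] is
bounded there, which bounds both rates, and it is uniformly continuous
([compact_unif_continuous]).

Continuity in [X] rests on the geometric meaning of the gap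
([gap_unit_sphere]): if [gap N X Y < d], every unit vector [x] of [X] has a
unit vector of [Y] within distance [2 * d], namely the normalized projection
of [x] onto [Y]. Uniform continuity of [D] turns this into closeness of the
sets of growth values of [X] and [Y] in the Hausdorff sense
([growth_values_close]), the modulus being the same for all pairs [X], [Y];
and sets of reals that are Hausdorff-close have close minima and maxima
([is_min_dist_lt], [is_max_dist_lt]).

Since [N] is an arbitrary norm while the topology is that of the sup norm, the
two have to be compared: [seminorm_bounded] gives one inequality, even for
seminorms, and [norm_lower_bound] the other one, by compactness of the sup-norm
unit sphere. The first inequality is also used for the seminorms
[fun x => N (A *m x)], where it shows that the supremum defining [opnorm N A]
is over a bounded set and that subspaces are closed. *)

Set Implicit Arguments.
Unset Strict Implicit.

(** * Compactness and extrema *)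

Section compactness.
Context {R : realType}.

(** Heine-Cantor. Continuity at [x] controls [f] on a ball of radius [r]; every
[d < r / 2] then works for all points within [r / 2] of [x], so the property
is local in the sense of near coverings. *)
Lemma compact_unif_continuous (U : pseudoMetricType R)
    (A : set U) (f : U -> R) :
  compact A -> {within A, continuous f} ->
  forall e : R, 0 < e -> exists2 d : R, 0 < d &
    forall x y, A x -> A y -> ball x d y -> `|f x - f y| < e.
Proof.
move=> cA /subspace_continuousP cf e e0.
pose P (d : R) x := A x -> forall y, A y -> ball x d y -> `|f x - f y| < e.
have near_P x : A x -> \forall y \near x & d \near (0 : R)^'+, P d y.
  move=> Ax; have /cvgrPdist_lt/(_ (e / 2)) := cf x Ax.
  rewrite divr_gt0// => /(_ isT).
  rewrite near_withinE => /nbhs_ballP[r /= r0 fr].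
  have r20 : 0 < r / 2 by rewrite divr_gt0.
  exists (ball x (r / 2), [set d | d < r / 2]) => /=.
    by split; [exact: nbhsx_ballx | exact: nbhs_right_lt].
  move=> [y d] /= [xy dr] Ay z Az yz.
  have yz' : ball y (r / 2) z by apply: le_ball yz; exact: ltW.
  have xz : ball x r z by rewrite (splitr r); exact: ball_triangle yz'.
  have xyr : ball x r y.
    by apply: le_ball xy; rewrite ler_pdivrMr// ler_peMr// ?ler1n// ltW.
  rewrite -(subrKA (f x)) (splitr e) (le_lt_trans (ler_normD _ _))// ltrD//.
    by rewrite distrC; exact: fr.
  exact: fr.
have := (compact_near_coveringP A).1 cA _ _ _ _ near_P.
move=> /(_ _); rewrite /at_right near_withinE => /nbhs_ballP[r /= r0 fr].
have r20 : 0 < r / 2 by rewrite divr_gt0.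
exists (r / 2) => // x y Ax Ay xy.
apply: (fr (r / 2)) xy => //.
by rewrite /ball/= sub0r normrN gtr0_norm// ltr_pdivrMr// ltr_pMr// ltr1n.
Qed.

Lemma is_min_compact (T : topologicalType) (A : set T) (f : T -> R) :
  A !=set0 -> compact A -> {within A, continuous f} ->
  is_min (f @` A) (set_min (f @` A)).
Proof.
move=> A0 cA cf; have [c Ac fc] := compact_EVT_min A0 cA cf.
suff mc : is_min (f @` A) (f c) by rewrite (set_minE mc).
split; first by exists c => //; exact: set_mem.
by move=> _ [x Ax <-]; apply: fc; exact: mem_set.
Qed.

Lemma is_max_compact (T : topologicalType) (A : set T) (f : T -> R) :
  A !=set0 -> compact A -> {within A, continuous f} ->
  is_max (f @` A) (set_max (f @` A)).
Proof.
move=> A0 cA cf; have [c Ac fc] := compact_EVT_max A0 cA cf.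
suff mc : is_max (f @` A) (f c) by rewrite (set_maxE mc).
split; first by exists c => //; exact: set_mem.
by move=> _ [x Ax <-]; apply: fc; exact: mem_set.
Qed.

Lemma is_min_dist_lt (A B : set R) (a b e : R) :
  is_min A a -> is_min B b ->
  (forall x, A x -> exists2 y, B y & `|x - y| < e) ->
  (forall y, B y -> exists2 x, A x & `|y - x| < e) -> `|a - b| < e.
Proof.
move=> [Aa lA] [Bb lB] AB BA.
have [y By ay] := AB a Aa; have [x Ax bx] := BA b Bb.
have := lA _ Ax; have := lB _ By.
rewrite distrC in bx.
move: ay bx; rewrite !ltr_distl => /andP[ay _] /andP[_ xb] bly alx.
by rewrite (le_lt_trans alx xb) andbT (le_lt_trans _ ay)// lerD2r.
Qed.

Lemma is_max_dist_lt (A B : set R) (a b e : R) :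
  is_max A a -> is_max B b ->
  (forall x, A x -> exists2 y, B y & `|x - y| < e) ->
  (forall y, B y -> exists2 x, A x & `|y - x| < e) -> `|a - b| < e.
Proof.
move=> [Aa uA] [Bb uB] AB BA.
have [y By ay] := AB a Aa; have [x Ax bx] := BA b Bb.
have := uA _ Ax; have := uB _ By.
rewrite distrC in bx.
move: ay bx; rewrite !ltr_distl => /andP[_ ay] /andP[bx _] yb xa.
by rewrite (lt_le_trans bx xa) (lt_le_trans ay)// lerD2r.
Qed.

End compactness.

(** * Seminorms on column vectors *)

Section seminorm.
Context {R : realType} {n : nat}.
Implicit Types (p : 'cV[R]_n -> R) (x y : 'cV[R]_n).

Definition is_seminorm p :=
  (forall (a : R) x, p (a *: x) = `|a| * p x) /\
  (forall x y, p (x + y) <= p x + p y).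

Lemma is_seminorm_mulmx p (A : 'M[R]_n) :
  is_seminorm p -> is_seminorm (fun x => p (A *m x)).
Proof.
by move=> [pZ pD]; split=> [a x|x y]; rewrite -?scalemxAr ?pZ// mulmxDr pD.
Qed.

Lemma seminormN p x : is_seminorm p -> p (- x) = p x.
Proof. by move=> [pZ _]; rewrite -scaleN1r pZ normrN normr1 mul1r. Qed.

Lemma seminorm0 p : is_seminorm p -> p 0 = 0.
Proof. by move=> [pZ _]; rewrite -(scale0r 0) pZ normr0 mul0r. Qed.

Lemma seminorm_ge0 p x : is_seminorm p -> 0 <= p x.
Proof.
move=> sp; have := sp.2 x (- x).
by rewrite subrr seminorm0// seminormN// -mulr2n pmulrn_lge0.
Qed.

Lemma coord_le_norm x i : `|x i 0| <= `|x|.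
Proof.
rewrite [leRHS]/Num.norm/= mx_normrE.
exact: (le_bigmax _ (fun ij => `|x ij.1 ij.2|) (i, 0)).
Qed.

(** Expand [x] in the canonical basis: [p x] is at most the sum of
[`|x i 0| * p (delta_mx i 0)]. *)
Lemma seminorm_bounded p : is_seminorm p ->
  exists2 C : R, 0 < C & forall x, p x <= C * `|x|.
Proof.
move=> sp; have [pZ pD] := sp.
have s0 : 0 <= \sum_i p (delta_mx i 0).
  by apply: sumr_ge0 => i _; exact: seminorm_ge0.
(* The summand 1 only serves to make the constant positive. *)
exists (1 + \sum_i p (delta_mx i 0)); first by rewrite ltr_pwDl.
move=> x; rewrite mulrDl mul1r ler_wpDl//.
rewrite {1}(matrix_sum_delta x) mulr_suml.
elim/big_ind2 : _ => [|a b c d ab cd|i _]; first by rewrite seminorm0.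
  by rewrite (le_trans (pD _ _))// lerD.
by rewrite big_ord1 pZ mulrC ler_wpM2l ?coord_le_norm//; exact: seminorm_ge0.
Qed.

Lemma seminorm_dist p x y : is_seminorm p -> `|p x - p y| <= p (x - y).
Proof.
move=> sp; have [_ pD] := sp.
rewrite ler_norml lerNl opprB !lerBlDr; apply/andP; split.
  by rewrite -(seminormN (x - y) sp) opprB -{1}(subrK x y) pD.
by rewrite -{1}(subrK y x) pD.
Qed.

Lemma seminorm_continuous p : is_seminorm p -> continuous p.
Proof.
move=> sp x; have [C C0 pC] := seminorm_bounded sp.
apply: (iffRL (@cvgrPdist_lt _ _ _ _ (nbhs_filter x) _ _)) => e e0.
apply/nbhs_ballP; exists (e / C); first by rewrite /= divr_gt0.
move=> y; rewrite -ball_normE /= => xy.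
rewrite (le_lt_trans (seminorm_dist _ _ sp))// (le_lt_trans (pC _))//.
by rewrite mulrC -ltr_pdivlMr.
Qed.

End seminorm.

(** * Heine-Borel for column vectors *)

Section columns.
Context {R : realType}.

Lemma mx_norm_trmx_le m n (A : 'M[R]_(m, n)) : `|A^T| <= `|A|.
Proof.
rewrite [leLHS]/Num.norm/= [in leLHS]mx_normrE.
apply/bigmax_leP; split => // -[i j] _ /=.
rewrite mxE [leRHS]/Num.norm/= mx_normrE.
exact: (le_bigmax _ (fun ij => `|A ij.1 ij.2|) (j, i)).
Qed.

Lemma trmx_continuous m n : continuous (@trmx R m n).
Proof.
move=> A; apply: (iffRL (@cvgrPdist_lt _ _ _ _ (nbhs_filter A) _ _)) => e e0.
apply/nbhs_ballP; exists e => //= B.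
rewrite -ball_normE /= => AB; rewrite -linearB.
exact: le_lt_trans (mx_norm_trmx_le _) AB.
Qed.

(** Transposition transfers [bounded_closed_compact] from rows to columns. *)
Lemma bounded_closed_compact_col n (A : set 'cV[R]_n) (M : R) :
  (forall x, A x -> `|x| <= M) -> closed A -> compact A.
Proof.
move=> AM clA.
have cB : compact (@trmx R 1 n @^-1` A).
  apply: bounded_closed_compact.
    exists M; split; first exact: num_real.
    move=> K MK v /= Av; rewrite -(trmxK v) (le_trans (mx_norm_trmx_le _))//.
    by rewrite (le_trans (AM _ Av))// ltW.
  by apply: preimage_closed => // v _; exact: trmx_continuous.
have -> : A = @trmx R 1 n @` (@trmx R 1 n @^-1` A).
  apply/seteqP; split => [x Ax|_ [v Av <-]//].
  by exists x^T => /=; rewrite trmxK.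
apply: continuous_compact cB; apply: continuous_subspaceT.
exact: trmx_continuous.
Qed.

End columns.

(** * Norms, their unit spheres and the gap *)

Section norm.
Context {R : realType} {n : nat} {N : 'cV[R]_n -> R} (normN : is_norm N).
Implicit Types (x y : 'cV[R]_n) (A : 'M[R]_n) (X Y : {vspace 'cV[R]_n}).

Lemma is_norm_seminorm : is_seminorm N.
Proof. by case: normN. Qed.
Let sN := is_norm_seminorm.

Lemma norm_gt0 x : x != 0 -> 0 < N x.
Proof.
move=> x0; have [N0 N1 _ _] := normN.
by rewrite lt_neqAle N0 andbT eq_sym; apply: contraNneq x0 => /N1 ->.
Qed.

Lemma unit_sphere_normalize x : x != 0 -> unit_sphere N ((N x)^-1 *: x).
Proof.
move=> x0; have Nx := norm_gt0 x0.
by rewrite /unit_sphere /= sN.1 gtr0_norm ?invr_gt0// mulVf ?gt_eqF.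
Qed.

(** The constant is the minimum of [N] on the compact sup-norm unit sphere, and
homogeneity extends the inequality to all vectors. *)
Lemma norm_lower_bound : exists2 c : R, 0 < c & forall x, c * `|x| <= N x.
Proof.
pose S := [set x : 'cV[R]_n | `|x| = 1].
have unitS x : x != 0 -> S (`|x|^-1 *: x).
  by move=> x0; rewrite /S /= normrZ normfV normr_id mulVf ?normr_eq0.
(* The sphere is empty in dimension 0. *)
have [S0|S0] := pselect (S !=set0); last first.
  exists 1 => // x; have [->|x0] := eqVneq x 0.
    by rewrite normr0 mulr0 seminorm0.
  by case: S0; exists (`|x|^-1 *: x); exact: unitS.
have cS : compact S.
  apply: (@bounded_closed_compact_col _ _ _ 1) => [x /= ->//|].
  apply: (@preimage_closed _ _ (fun x : 'cV[R]_n => `|x|) [set r | r = 1]).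
    by move=> x _; exact: norm_continuous.
  exact: closed_eq.
have cN : {within S, continuous N}.
  by apply: continuous_subspaceT; exact: seminorm_continuous.
have [c /set_mem Sc cmin] := compact_EVT_min S0 cS cN.
have c0 : c != 0.
  apply/eqP => c0; move: Sc.
  by rewrite /S /= c0 normr0 => /esym/eqP; rewrite oner_eq0.
exists (N c); first exact: norm_gt0.
move=> x; have [->|x0] := eqVneq x 0; first by rewrite normr0 mulr0 seminorm0.
have := cmin _ (mem_set (unitS _ x0)).
by rewrite sN.1 normfV normr_id ler_pdivlMl ?normr_gt0// mulrC.
Qed.

Lemma unit_sphere_compact : compact (unit_sphere N).
Proof.
have [c c0 cN] := norm_lower_bound.
apply: (@bounded_closed_compact_col _ _ _ c^-1).
  by move=> x xS; rewrite -[leRHS]mul1r ler_pdivlMr// mulrC -xS cN.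
apply: (@preimage_closed _ _ N [set r | r = 1]); last exact: closed_eq.
by move=> x _; exact: seminorm_continuous.
Qed.

Lemma le_opnorm A x : unit_sphere N x -> N (A *m x) <= opnorm N A.
Proof.
move=> xS; apply: ub_le_sup; last by exists x.
have [C C0 AC] := seminorm_bounded (is_seminorm_mulmx A sN).
have [c c0 cN] := norm_lower_bound.
exists (C / c) => _ [y yS <-]; rewrite (le_trans (AC y))// ler_pM2l//.
by rewrite -[leRHS]mul1r ler_pdivlMr// mulrC -yS cN.
Qed.

Lemma gapC X Y : gap N X Y = gap N Y X.
Proof.
rewrite /gap /opnorm; congr sup; apply: eq_imagel => x _.
by rewrite -opprB mulNmx seminormN.
Qed.

(** For [x] in [X] the residue [x - orthproj X *m x] lies in [X] and is
orthogonal to [X], hence to itself. *)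
Lemma orthproj_id X x : x \in X -> orthproj X *m x = x.
Proof.
move=> xX; have [PxX ort] := orthprojP X x.
by apply/esym/subr0_eq/dot_eq0/ort; rewrite memvB.
Qed.

(** A subspace is the zero set of the continuous seminorm
[fun x => N (x - orthproj X *m x)]. *)
Lemma vspace_closed X : closed [set x | x \in X].
Proof.
have -> : [set x | x \in X] =
    (fun x => N ((1%:M - orthproj X) *m x)) @^-1` [set r | r = 0].
  apply/seteqP; split => x /=; rewrite mulmxBl mul1mx => xX.
    by rewrite orthproj_id// subrr seminorm0.
  have [_ N0 _ _] := normN.
  by rewrite (subr0_eq (N0 _ xX)); have [] := orthprojP X x.
apply: preimage_closed; last exact: closed_eq.
by move=> x _; exact: (seminorm_continuous (is_seminorm_mulmx _ sN)).
Qed.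

(** The projection [z] of [x] onto [Y] satisfies [N (x - z) < d], because
[x - z] is the image of [x] under the difference of the two projections.
Normalizing [z] moves it by [`|N z - 1|], which is again less than [d]; the
bound [d <= 1] ensures that [z] is nonzero. *)
Lemma gap_unit_sphere X Y x (d : R) : gap N X Y < d -> d <= 1 ->
  x \in X -> unit_sphere N x ->
  exists y, [/\ y \in Y, unit_sphere N y & N (x - y) < 2 * d].
Proof.
move=> XYd d1 xX xS; pose z := orthproj Y *m x.
have zY : z \in Y by have [] := orthprojP Y x.
have xz : N (x - z) < d.
  apply: le_lt_trans XYd; rewrite -{1}(orthproj_id xX) -mulmxBl.
  exact: le_opnorm.
have z0 : z != 0 by apply: contraTneq xz => ->; rewrite subr0 xS -leNgt.
exists ((N z)^-1 *: z).
split; [exact: memvZ | exact: unit_sphere_normalize |].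
have zz : N (z - (N z)^-1 *: z) <= N (x - z).
  have Nz := norm_gt0 z0.
  rewrite -[X in N (X - _)]scale1r -scalerBl sN.1.
  rewrite -{2}(gtr0_norm Nz) -normrM mulrBl mul1r mulVf ?gt_eqF//.
  by rewrite -{1}xS distrC; exact: seminorm_dist.
rewrite -(subrKA z) (le_lt_trans (sN.2 _ _))//.
by rewrite mulr2n mulrDl mul1r ltrD// (le_lt_trans zz).
Qed.

End norm.

(** * Values of a continuous function over the unit vectors of a subspace *)

Section rates.
Context {R : realType} {n : nat} {N : 'cV[R]_n -> R} (normN : is_norm N).
Context {K : set (R * R)} (cK : compact K) (K0 : K !=set0).
Context {D : 'cV[R]_n * (R * R) -> R}
  (cD : {within unit_sphere N `*` K, continuous D}).
Implicit Types (X Y : {vspace 'cV[R]_n}).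

Let dom X := ([set x | x \in X] `&` unit_sphere N) `*` K.

Lemma growth_domain_compact X : compact (dom X).
Proof.
apply: compact_setX cK.
apply: subclosed_compact (unit_sphere_compact normN) _ => [|x []//].
apply: closedI; first exact: vspace_closed normN _.
apply: compact_closed (unit_sphere_compact normN); exact: norm_hausdorff.
Qed.

Lemma growth_domain_neq0 X : (0 < \dim X)%N -> dom X !=set0.
Proof.
move=> X0; have [p Kp] := K0.
have v0 : vpick X != 0 by rewrite vpick0 -dimv_eq0 -lt0n.
exists ((N (vpick X))^-1 *: vpick X, p); split => //; split => /=.
  by rewrite memvZ// memv_pick.
exact: unit_sphere_normalize.
Qed.

Lemma growth_domain_continuous X : {within dom X, continuous D}.
Proof. by apply: continuous_subspaceW cD => -[x p] [[_ ?] ?]. Qed.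

Lemma growth_values_bounded : exists M : R,
  forall X r, (D @` dom X) r -> `|r| <= M.
Proof.
have cSK := compact_setX (unit_sphere_compact normN) cK.
have /compact_bounded/ex_strict_bound_gt0[M M0 /= DM] :=
  continuous_compact cD cSK.
exists M => X _ [[x p] [[_ xS] Kp] <-].
by apply/ltW/DM; exists (x, p).
Qed.

Lemma growth_values_close (e : R) : 0 < e -> exists2 d : R, 0 < d &
  forall X Y, gap N X Y < d -> forall r, (D @` dom X) r ->
    exists2 s, (D @` dom Y) s & `|r - s| < e.
Proof.
move=> e0; have cSK := compact_setX (unit_sphere_compact normN) cK.
have [d d0 Dd] := compact_unif_continuous cSK cD e0.
have [c c0 cN] := norm_lower_bound normN.
(* A gap below [c * d / 2] gives [N (x - y) < c * d], that is, a sup-norm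
   distance below [d]. *)
exists (Num.min 1 (c * d / 2)); first by rewrite lt_min ltr01 !mulr_gt0.
move=> X Y XY _ [[x p] /= [[/= xX xS] Kp] <-].
have [|y [yY yS xy]] := gap_unit_sphere normN XY _ xX xS.
  by rewrite ge_min lexx.
exists (D (y, p)); first by exists (y, p).
apply: Dd => //; split => /=; last exact: ballxx.
rewrite -ball_normE /= -(ltr_pM2l c0) (le_lt_trans (cN _))//.
by rewrite (lt_le_trans xy)// mulrC -ler_pdivlMr// ge_min lexx orbT.
Qed.

End rates.

(** * Continuity and boundedness of the growth rates *)

Section off_diagonal.
Context {R : realType} {I : set R} (cI : compact I).

(** On the empty set [set_min] and [set_max] are the same default value, so the
strict inequality excludes it; then [set_min I] and [set_max I] are distinct
elements of [I]. *)
Lemma off_diag_neq0 : set_min I < set_max I -> off_diag I !=set0.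
Proof.
move=> I_lt; have [I0|/set0P I0] := eqVneq I set0.
  exfalso; move: I_lt; rewrite I0.
  suff -> : set_min (set0 : set R) = set_max set0 by rewrite ltxx.
  by congr (get _); apply/funext => m; apply/propext; split => -[].
have cid : {within I, continuous (@id R)}.
  by apply: continuous_subspaceT => x; exact: cvg_id.
have [Im _] := is_min_compact I0 cI cid.
have [IM _] := is_max_compact I0 cI cid.
rewrite image_id in Im IM.
by exists (set_min I, set_max I); split => //=; rewrite lt_eqF.
Qed.

Lemma closure_off_diag_compact : compact (closure (off_diag I)).
Proof.
have cII := compact_setX cI cI.
have clII : closed (I `*` I).
  by apply: compact_closed cII; exact: norm_hausdorff.
apply: subclosed_compact cII _; first exact: closed_closure.
rewrite (iffLR (closure_id _) clII).
by apply: closure_subset => -[t s] [/= It Is _].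
Qed.

End off_diagonal.

Theorem proposition2p14 (R : realType) (n : nat) (n_ge1 : (1 <= n)%N)
    (N : 'cV[R]_n -> R) (normN : is_norm N)
    (I : set R) (cI : compact I) (I_lt : set_min I < set_max I)
    (Phi : R -> R -> 'M[R]_n) (PhiLP : LP N I Phi)
    (k : nat) (k_range : (1 <= k <= n)%N) :
  (gap_continuous_on N (Gr k) (lower_rate N I Phi) /\
   bounded_real_on (Gr k) (lower_rate N I Phi)) /\
  (gap_continuous_on N (Gr k) (upper_rate N I Phi) /\
   bounded_real_on (Gr k) (upper_rate N I Phi)).
Proof.
have cK := closure_off_diag_compact cI.
have K0 : closure (off_diag I) !=set0.
  by have [p Ip] := off_diag_neq0 cI I_lt; exists p; exact: subset_closure.
have [cD _] := getPex PhiLP.2; rewrite -/(delta_ext N I Phi) in cD.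
have [k0 _] := andP k_range.
have dom0 X : Gr k X ->
    ([set x | x \in X] `&` unit_sphere N) `*` closure (off_diag I) !=set0.
  by move=> Xk; apply: growth_domain_neq0 => //; rewrite Xk.
have Gr_min X : Gr k X ->
    is_min (growth_values N I Phi X) (lower_rate N I Phi X).
  move=> /dom0 X0; apply: is_min_compact X0 _ _.
    exact: growth_domain_compact.
  exact: growth_domain_continuous.
have Gr_max X : Gr k X ->
    is_max (growth_values N I Phi X) (upper_rate N I Phi X).
  move=> /dom0 X0; apply: is_max_compact X0 _ _.
    exact: growth_domain_compact.
  exact: growth_domain_continuous.
have [M valM] := growth_values_bounded normN cK cD.
split; split.
- move=> X GX e e0; have [d d0 close] := growth_values_close normN cK cD e0.
  exists d => // Y GY XY; apply: is_min_dist_lt (Gr_min _ GX) (Gr_min _ GY) _ _.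
    exact: close.
  by apply: close; rewrite gapC.
- by exists M => X GX; apply: (valM X); have [] := Gr_min _ GX.
- move=> X GX e e0; have [d d0 close] := growth_values_close normN cK cD e0.
  exists d => // Y GY XY; apply: is_max_dist_lt (Gr_max _ GX) (Gr_max _ GY) _ _.
    exact: close.
  by apply: close; rewrite gapC.
- by exists M => X GX; apply: (valM X); have [] := Gr_max _ GX.
Qed.
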